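(* Consider applying the gradient method $x_{k+1}=x_k-\alpha_k g_k$, $g_k=\nabla f(x_k)=Ax_k-b$, to the problem $\min_{x\in\mathbb{R}^n} f(x)=\frac12 x^{T}Ax-b^{T}x$, with stepsize $$\alpha_k=\gamma\,\frac{g_k^{T}\psi(A)g_k}{g_k^{T}\psi(A)A g_k},\qquad \gamma\in(0,1],$$ and let $x_*=A^{-1}b$. Then $$\|x_{k+1}-x_*\|_{\psi(A)A}^2\le\left(1-\frac{4\gamma(2-\gamma)\mu L}{(L+\mu)^2}\right)\|x_k-x_*\|_{\psi(A)A}^2 .$$ Moreover, if $x_k=A^{-1}\left(\frac{1}{\sqrt2}\,\psi^{-\frac12}(A)(\xi_1\pm\xi_n)+b\right)$ (for either choice of sign), then the two sides of this inequality are equal.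
   Context: Here $b\in\mathbb{R}^n$ and $A\in\mathbb{R}^{n\times n}$ is symmetric positive definite with eigenvalues $\lambda_1,\dots,\lambda_n$ and associated orthonormal eigenvectors $\xi_1,\dots,\xi_n$. It is assumed (without loss of generality) that $A=\mathrm{diag}\{\lambda_1,\lambda_2,\dots,\lambda_n\}$ with $0<\mu=\lambda_1<\lambda_2<\cdots<\lambda_n=L$ (so $n\ge 2$). The function $\psi$ is real analytic on $[\mu,L]$ and can be expressed by a Laurent series $\psi(z)=\sum_{k=-\infty}^{\infty}c_kz^k$ with $c_k\in\mathbb{R}$ such that $0<\sum_{k=-\infty}^{\infty}c_kz^k<+\infty$ for all $z\in[\mu,L]$. The matrix $\psi(A)$ (and likewise $\psi^{-1/2}(A)$) is defined by the usual functional calculus: $\psi(A)\xi_i=\psi(\lambda_i)\xi_i$ and $\psi^{-1/2}(A)\xi_i=\psi(\lambda_i)^{-1/2}\xi_i$. For a symmetric positive definite matrix $D$, $\|x\|_D=\sqrt{x^{T}Dx}$. The stepsize is defined at iterates with $g_k\neq 0$. *)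

(* Defs.v *)
From HB Require Import structures.
From mathcomp Require Import all_boot all_order all_algebra.
From mathcomp Require Import all_classical all_reals all_analysis.
From mathcomp Require Import ring.

Set Implicit Arguments.
Unset Strict Implicit.
Unset Printing Implicit Defensive.

Import Order.TTheory GRing.Theory Num.Theory.
Import numFieldNormedType.Exports.

Local Open Scope classical_set_scope.
Local Open Scope ring_scope.

Definition dotcv (R : realType) (n : nat) (u v : 'cV[R]_n) : R :=
  (u^T *m v) 0 0.

Definition posdefmx (R : realType) (n : nat) (D : 'M[R]_n) : Prop :=
  D^T = D /\ forall v : 'cV[R]_n, v != 0 -> 0 < dotcv v (D *m v).

Definition normmx (R : realType) (n : nat) (D : 'M[R]_n) (v : 'cV[R]_n) : R :=
  Num.sqrt (dotcv v (D *m v)).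

Definition orthonormal_eigenbasis (R : realType) (n : nat) (A : 'M[R]_n)
    (lam : 'I_n -> R) (xi : 'I_n -> 'cV[R]_n) : Prop :=
  (forall i j, dotcv (xi i) (xi j) = (i == j)%:R) /\
  (forall i, A *m xi i = lam i *: xi i).

(* For an orthonormal eigenbasis (lam, xi) of A this is h(A): see funmx_eigen. *)
Definition funmx (R : realType) (n : nat) (lam : 'I_n -> R)
    (xi : 'I_n -> 'cV[R]_n) (h : R -> R) : 'M[R]_n :=
  \sum_i h (lam i) *: (xi i *m (xi i)^T).

Lemma funmx_eigen (R : realType) (n : nat) (A : 'M[R]_n) (lam : 'I_n -> R)
    (xi : 'I_n -> 'cV[R]_n) (h : R -> R) (i : 'I_n) :
  orthonormal_eigenbasis A lam xi ->
  funmx lam xi h *m xi i = h (lam i) *: xi i.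
Proof.
case=> xiP _; rewrite /funmx mulmx_suml (bigD1 i) //= big1 => [|j ji].
  rewrite addr0 -scalemxAl -mulmxA [_^T *m _]mx11_scalar.
  by rewrite -/(dotcv _ _) xiP eqxx mulmx1.
rewrite -scalemxAl -mulmxA [_^T *m _]mx11_scalar -/(dotcv _ _) xiP.
by rewrite (negbTE ji) mul_mx_scalar scale0r scaler0.
Qed.

(* The expansion at z0 is only required to represent f relatively to [a, b],
   i.e. one-sidedly at the endpoints. *)
Definition analytic_on_itv (R : realType) (a b : R) (f : R -> R) : Prop :=
  forall z0, a <= z0 <= b ->
    exists2 r, 0 < r &
    exists u : nat -> R, forall z, a <= z <= b -> `|z - z0| < r ->
      pseries u (z - z0) @ \oo --> f z.

(* \sum_{k in Z} c_k z^k = s, the parts k >= 0 and k < 0 converging separately;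
   Negz i is the integer - (i + 1). *)
Definition laurent_sum (R : realType) (c : int -> R) (z s : R) : Prop :=
  exists sp sn : R,
    [/\ [series c (Posz i) * z ^ Posz i]_i @ \oo --> sp,
        [series c (Negz i) * z ^ Negz i]_i @ \oo --> sn
      & s = sp + sn].

Definition quad (R : realType) (n : nat) (A : 'M[R]_n) (b x : 'cV[R]_n) : R :=
  2^-1 * dotcv x (A *m x) - dotcv b x.

(* The dimension is a successor because the norm on matrices needs it. *)
Definition grad (R : realType) (n : nat) (f : 'cV[R]_n.+1 -> R)
    (x : 'cV[R]_n.+1) : 'cV[R]_n.+1 :=
  \col_i 'D_(delta_mx i 0) f x.

Lemma grad_quad (R : realType) (n : nat) (A : 'M[R]_n.+1) (b x : 'cV[R]_n.+1) :
  A^T = A -> grad (quad A b) x = A *m x - b.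
Proof.
move=> At; apply/matrixP => i j; rewrite !mxE (ord1 j).
set v := delta_mx i 0.
have dl (u w w' : 'cV[R]_n.+1) : dotcv u (w + w') = dotcv u w + dotcv u w'.
  by rewrite /dotcv mulmxDr mxE.
have dZ (u w : 'cV[R]_n.+1) a : dotcv u (a *: w) = a * dotcv u w.
  by rewrite /dotcv -scalemxAr mxE.
have dC (u w : 'cV[R]_n.+1) : dotcv u w = dotcv w u.
  by rewrite /dotcv !mxE; apply: eq_bigr => k _; rewrite !mxE mulrC.
have dA (u w : 'cV[R]_n.+1) : dotcv u (A *m w) = dotcv w (A *m u).
  by rewrite dC /dotcv trmx_mul At mulmxA.
have dv (u : 'cV[R]_n.+1) : dotcv v u = u i 0.
  rewrite /dotcv mxE (bigD1 i) //= big1 => [|k ki].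
    by rewrite !mxE !eqxx addr0 mul1r.
  by rewrite !mxE (negbTE ki) mul0r.
pose d := (A *m x) i 0 - b i 0.
pose q := 2^-1 * dotcv v (A *m v).
apply: (@cvg_lim R) => //.
have -> : (\sum_k A i k * x k 0 - b i 0) = d + 0 * q.
  by rewrite /d mxE mul0r addr0.
have : (fun h : R => d + h * q) @ 0^' --> d + 0 * q.
  apply: (cvg_trans (cvg_app _ (@nbhs_dnbhs _ _))).
  apply: cvgD; first exact: cvg_cst.
  by apply: cvgM; [exact: cvg_id | exact: cvg_cst].
apply: cvg_trans; apply: near_eq_cvg.
near=> h.
have h0 : h != 0 by near: h; exact: nbhs_dnbhs_neq.
have lD (u u' w : 'cV[R]_n.+1) : dotcv (u + u') w = dotcv u w + dotcv u' w.
  by rewrite dC dl ![dotcv w _]dC.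
have lZ (u w : 'cV[R]_n.+1) a : dotcv (a *: u) w = a * dotcv u w.
  by rewrite dC dZ dC.
rewrite /= /quad mulmxDr -scalemxAr !dl !lD !lZ !dZ [dotcv x (A *m v)]dA.
rewrite [dotcv b v]dC /q /d -!dv /GRing.scale /=.
by field.
Unshelve. all: by end_near. Qed.

Definition stepsize (R : realType) (n : nat) (gamma : R) (P A : 'M[R]_n)
    (g : 'cV[R]_n) : R :=
  gamma * (dotcv g (P *m g) / dotcv g (P *m A *m g)).

(* Main.v *)
Require Import Defs.
From mathcomp Require Import all_boot all_order all_algebra.
From mathcomp Require Import all_classical all_reals all_analysis.
From mathcomp Require Import ring lra.

Set Implicit Arguments.
Unset Strict Implicit.
Unset Printing Implicit Defensive.

Import Order.TTheory GRing.Theory Num.Theory.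
Import numFieldNormedType.Exports.

Local Open Scope classical_set_scope.
Local Open Scope ring_scope.

(** Let [e = x k - xstar], so that the gradient is [g = A e], and give the
    eigenvalue [lam i] the weight [w i = psi (lam i) * (xi i . g) ^+ 2].  In
    the eigenbasis every quadratic form in the theorem is a moment of [w]:
    with [S = \sum w i], [T = \sum w i * lam i] and [H = \sum w i / lam i],
    the numerator and denominator of the stepsize are [S] and [T], and the
    squared error is [H].  Expanding the square, a step of length [a] along
    [g] turns the squared error into [H - 2 a S + a ^+ 2 T]
    ([sqnorm_gradient_step]), which for [a = gamma * S / T] is
    [H - gamma * (2 - gamma) * S ^+ 2 / T].

    The theorem thus reduces to [4 mu L T H <= (mu + L) ^+ 2 S ^+ 2], the
    Kantorovich inequality for the weights [w] and the nodes [lam i] in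
    [[mu, L]] ([kantorovich]).  It is an equality when the mass of [w] is
    split evenly between [mu] and [L].  At the exceptional points the gradient
    is [psi(A)^(-1/2) (xi_1 +- xi_n)], divided by [sqrt 2], so the factor
    [psi] of [w] cancels and [w] is exactly this measure
    ([moment_extremal_gradient]). *)

(** * The Kantorovich inequality *)

(** Since [(t i - m) * (M - t i) >= 0], each node satisfies
    [t i + m M / t i <= m + M]; summing against [w] bounds
    [\sum w t + m M \sum w / t] linearly, and AM-GM turns this sum into the
    product. *)
Lemma kantorovich (R : realFieldType) (I : finType) (w t : I -> R) (m M : R) :
  0 < m -> (forall i, m <= t i <= M) -> (forall i, 0 <= w i) ->
  4 * m * M * (\sum_i w i * t i) * (\sum_i w i / t i)
    <= (m + M) ^+ 2 * (\sum_i w i) ^+ 2.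
Proof.
move=> m0 tP w0; set T := \sum_i w i * t i; set H := \sum_i w i / t i.
set S := \sum_i w i.
have lin : T + m * M * H <= (m + M) * S.
  rewrite /T /H /S !mulr_sumr -big_split /=; apply: ler_sum => i _.
  have /andP[mt tM] := tP i; have t0 : 0 < t i by exact: lt_le_trans mt.
  have -> : w i * t i + m * M * (w i / t i) = w i * (t i + m * M / t i).
    by field; rewrite gt_eqF.
  rewrite [leRHS]mulrC ler_wpM2l // -(ler_pM2r t0).
  have -> : (t i + m * M / t i) * t i = t i * t i + m * M.
    by field; rewrite gt_eqF.
  have : 0 <= (t i - m) * (M - t i) by rewrite mulr_ge0 ?subr_ge0.
  by lra.
have [i0 _ | I0] := pickP I; last first.
  by rewrite /T /H big_pred0 // mulr0 mul0r mulr_ge0 ?sqr_ge0.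
have M0 : 0 < M.
  by have /andP[mt tM] := tP i0; apply: lt_le_trans m0 (le_trans mt tM).
have T0 : 0 <= T.
  apply: sumr_ge0 => i _; have /andP[mt _] := tP i.
  by rewrite mulr_ge0 // (le_trans (ltW m0)).
have H0 : 0 <= H.
  apply: sumr_ge0 => i _; have /andP[mt _] := tP i.
  by rewrite divr_ge0 // (le_trans (ltW m0)).
have amgm : 4 * m * M * T * H <= (T + m * M * H) ^+ 2.
  rewrite -subr_ge0.
  have -> : (T + m * M * H) ^+ 2 - 4 * m * M * T * H = (T - m * M * H) ^+ 2.
    by ring.
  exact: sqr_ge0.
apply: le_trans amgm _; rewrite -exprMn.
have X0 : 0 <= T + m * M * H by rewrite addr_ge0 // mulr_ge0 // mulr_ge0 // ltW.
by rewrite lerXn2r ?nnegrE // (le_trans X0).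
Qed.

(** * Coordinates in an orthonormal eigenbasis *)

Lemma dotcvC (R : realType) (n : nat) (u v : 'cV[R]_n) : dotcv u v = dotcv v u.
Proof. by rewrite /dotcv !mxE; apply: eq_bigr => k _; rewrite !mxE mulrC. Qed.

Lemma dotcvD (R : realType) (n : nat) (u v w : 'cV[R]_n) :
  dotcv u (v + w) = dotcv u v + dotcv u w.
Proof. by rewrite /dotcv mulmxDr mxE. Qed.

Lemma dotcvZ (R : realType) (n : nat) (u v : 'cV[R]_n) (a : R) :
  dotcv u (a *: v) = a * dotcv u v.
Proof. by rewrite /dotcv -scalemxAr mxE. Qed.

Lemma dotcvB (R : realType) (n : nat) (u v w : 'cV[R]_n) :
  dotcv u (v - w) = dotcv u v - dotcv u w.
Proof. by rewrite dotcvD -scaleN1r dotcvZ mulN1r. Qed.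

Lemma dotcv_funmx (R : realType) (n : nat) (lam : 'I_n -> R)
    (xi : 'I_n -> 'cV[R]_n) (h : R -> R) (u v : 'cV[R]_n) :
  dotcv u (funmx lam xi h *m v)
    = \sum_i h (lam i) * (dotcv (xi i) u * dotcv (xi i) v).
Proof.
rewrite /dotcv /funmx mulmx_suml mulmx_sumr summxE; apply: eq_bigr => i _.
rewrite -scalemxAl -scalemxAr mxE -mulmxA [u^T *m _]mulmxA; congr (_ * _).
by rewrite mxE big_ord1; congr (_ * _); exact: dotcvC.
Qed.

(** The matrix [X] whose columns are the [xi i] satisfies [X^T X = 1]; as [X]
    is square this gives [X X^T = 1], which is the sum on the left. *)
Lemma funmx_cst1 (R : realType) (n : nat) (A : 'M[R]_n) (lam : 'I_n -> R)
    (xi : 'I_n -> 'cV[R]_n) (hxi : orthonormal_eigenbasis A lam xi) :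
  funmx lam xi (fun=> 1) = 1%:M.
Proof.
pose X : 'M[R]_n := \matrix_(i, j) xi j i 0.
have XX : X^T *m X = 1%:M.
  apply/matrixP => i j; rewrite [RHS]mxE -(hxi.1 i j) /dotcv !mxE.
  by apply: eq_bigr => k _; rewrite !mxE.
rewrite -(mulmx1C XX); apply/matrixP => i j; rewrite /funmx summxE !mxE.
by apply: eq_bigr => k _; rewrite !mxE big_ord1 !mxE mul1r.
Qed.

Lemma funmx_mulA (R : realType) (n : nat) (A : 'M[R]_n) (lam : 'I_n -> R)
    (xi : 'I_n -> 'cV[R]_n) (h : R -> R) :
  A^T = A -> orthonormal_eigenbasis A lam xi ->
  funmx lam xi h *m A = funmx lam xi (fun z => h z * z).
Proof.
move=> At hxi; rewrite /funmx mulmx_suml; apply: eq_bigr => i _.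
rewrite -scalemxAl -mulmxA -{1}At -trmx_mul hxi.2 linearZ /=.
by rewrite -scalemxAr scalerA.
Qed.

Lemma dotcv_eigen_mul (R : realType) (n : nat) (A : 'M[R]_n) (lam : 'I_n -> R)
    (xi : 'I_n -> 'cV[R]_n) (v : 'cV[R]_n) (i : 'I_n) :
  A^T = A -> orthonormal_eigenbasis A lam xi ->
  dotcv (xi i) (A *m v) = lam i * dotcv (xi i) v.
Proof.
move=> At hxi; rewrite /dotcv mulmxA -{1}At -trmx_mul hxi.2 linearZ /=.
by rewrite -scalemxAl mxE.
Qed.

(** The inverse is the matrix function of [z^-1]. *)
Lemma unitmx_eigen (R : realType) (n : nat) (A : 'M[R]_n) (lam : 'I_n -> R)
    (xi : 'I_n -> 'cV[R]_n) :
  A^T = A -> orthonormal_eigenbasis A lam xi -> (forall i, lam i != 0) ->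
  A \in unitmx.
Proof.
move=> At hxi lam0; suff /mulmx1_unit[] : funmx lam xi GRing.inv *m A = 1%:M by [].
rewrite (funmx_mulA GRing.inv At hxi) -(funmx_cst1 hxi).
by apply: eq_bigr => i _; rewrite mulVf.
Qed.

(** By completeness of the eigenbasis a nonzero vector has a nonzero
    coordinate, which contributes a positive term to the form. *)
Lemma funmx_form_gt0 (R : realType) (n : nat) (A : 'M[R]_n) (lam : 'I_n -> R)
    (xi : 'I_n -> 'cV[R]_n) (h : R -> R) (v : 'cV[R]_n) :
  orthonormal_eigenbasis A lam xi -> (forall i, 0 < h (lam i)) -> v != 0 ->
  0 < dotcv v (funmx lam xi h *m v).
Proof.
move=> hxi h0 v0; rewrite dotcv_funmx lt_neqAle eq_sym.
have ge0 i : 0 <= h (lam i) * (dotcv (xi i) v * dotcv (xi i) v).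
  by rewrite mulr_ge0 ?(ltW (h0 i)) // -expr2 sqr_ge0.
rewrite sumr_ge0 // andbT; apply: contra v0; rewrite psumr_eq0 // => /allP v0.
rewrite -[v]mul1mx -(funmx_cst1 hxi) /funmx mulmx_suml big1 // => i _.
have := v0 i (mem_index_enum i).
rewrite /= mulf_eq0 gt_eqF //= -expr2 sqrf_eq0 => /eqP vi.
rewrite scale1r -mulmxA [_^T *m _]mx11_scalar -/(dotcv _ _) vi.
by rewrite mul_mx_scalar scale0r.
Qed.

(** * Gradient steps *)

Lemma sqnorm_gradient_step (R : realType) (n : nat) (A : 'M[R]_n)
    (lam : 'I_n -> R) (xi : 'I_n -> 'cV[R]_n) (h : R -> R) (e : 'cV[R]_n)
    (a : R) :
  A^T = A -> orthonormal_eigenbasis A lam xi ->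
  let P := funmx lam xi h in
  let g := A *m e in
  dotcv (e - a *: g) (P *m A *m (e - a *: g))
    = dotcv e (P *m A *m e) - 2 * a * dotcv g (P *m g)
      + a ^+ 2 * dotcv g (P *m A *m g).
Proof.
move=> At hxi P g; rewrite /P (funmx_mulA h At hxi) !dotcv_funmx !mulr_sumr.
rewrite -sumrB -big_split /=; apply: eq_bigr => i _.
by rewrite dotcvB dotcvZ /g (dotcv_eigen_mul _ _ At hxi); ring.
Qed.

(** The step [S / T] is stationary for the squared error along [g]; scaled by
    [gamma], it makes the linear term [-2 gamma S ^+ 2 / T] and the quadratic
    one [gamma ^+ 2 S ^+ 2 / T], with [S] and [T] the two forms at [g]. *)
Lemma sqnorm_stepsize (R : realType) (n : nat) (A : 'M[R]_n)
    (lam : 'I_n -> R) (xi : 'I_n -> 'cV[R]_n) (h : R -> R) (e : 'cV[R]_n)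
    (gamma : R) :
  A^T = A -> orthonormal_eigenbasis A lam xi ->
  let P := funmx lam xi h in
  let g := A *m e in
  let e' := e - stepsize gamma P A g *: g in
  dotcv g (P *m A *m g) != 0 ->
  dotcv e' (P *m A *m e') = dotcv e (P *m A *m e)
    - gamma * (2 - gamma) * (dotcv g (P *m g) ^+ 2 / dotcv g (P *m A *m g)).
Proof.
move=> At hxi P g e' T0; rewrite /e' (sqnorm_gradient_step _ _ _ At hxi).
by rewrite /stepsize -/P -/g; field.
Qed.

(** * The spectral measure of the extremal gradients *)

(** The coordinates of [v] are [psi(lam i)^(-1/2) / sqrt 2] at the two extreme
    indices, up to sign, and zero elsewhere; the sign disappears on squaring,
    and the weight left at each extreme eigenvalue is [1/2]. *)
Lemma moment_extremal_gradient (R : realType) (n : nat) (A : 'M[R]_n.+2)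
    (lam : 'I_n.+2 -> R) (xi : 'I_n.+2 -> 'cV[R]_n.+2) (psi f : R -> R)
    (eps : R) :
  orthonormal_eigenbasis A lam xi -> (forall i, 0 < psi (lam i)) ->
  eps ^+ 2 = 1 ->
  let v := (Num.sqrt 2)^-1 *: (funmx lam xi (fun z => psi z `^ (- 2^-1))
                                 *m (xi ord0 + eps *: xi ord_max)) in
  \sum_i psi (lam i) * dotcv (xi i) v ^+ 2 * f (lam i)
    = (f (lam ord0) + f (lam ord_max)) / 2.
Proof.
move=> hxi psi0 eps1 v.
have s2 : (Num.sqrt 2 : R)^-1 ^+ 2 = 2^-1 by rewrite exprVn sqr_sqrtr.
have half i : psi (lam i) * (psi (lam i) `^ (- 2^-1)) ^+ 2 = 1.
  rewrite -powR_mulrn ?powR_ge0 // -powRrM mulNr mulVf ?pnatr_eq0 //.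
  by rewrite powR_inv1 ?ltW // divff // gt_eqF.
have vE i : dotcv (xi i) v = (Num.sqrt 2)^-1 * (psi (lam i) `^ (- 2^-1)
    * ((i == ord0)%:R + eps * (i == ord_max)%:R)).
  rewrite /v mulmxDr -scalemxAr !(funmx_eigen _ _ hxi) dotcvZ dotcvD !dotcvZ.
  rewrite !hxi.1; congr (_ * _).
  case: eqVneq => [->|_]; case: eqVneq => [->|_] /=; ring.
have ends : (ord_max : 'I_n.+2) != ord0 by [].
rewrite (bigD1 ord0) //= (bigD1 ord_max) //= big1 => [|i /andP[i0 im]].
  rewrite !vE !exprMn s2 !eqxx (negbTE ends) [ord0 == _]eq_sym (negbTE ends).
  rewrite mulr0 mulr1 addr0 add0r expr1n eps1 !mulr1.
  by rewrite ![psi _ * (2^-1 * _)]mulrCA !half; ring.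
by rewrite vE (negbTE i0) (negbTE im) mulr0 addr0 !mulr0 expr0n /= mulr0 mul0r.
Qed.

Theorem theorem1 (R : realType) (n : nat)
    (A : 'M[R]_n.+2) (b : 'cV[R]_n.+2)
    (lam : 'I_n.+2 -> R) (xi : 'I_n.+2 -> 'cV[R]_n.+2) (mu L : R)
    (c : int -> R) (psi : R -> R) (gamma : R) (x : nat -> 'cV[R]_n.+2)
    (hA : posdefmx A)
    (hxi : orthonormal_eigenbasis A lam xi)
    (hlam : forall i j : 'I_n.+2, (i < j)%N -> lam i < lam j)
    (hmu0 : 0 < mu) (hmu : lam ord0 = mu) (hL : lam ord_max = L)
    (hpsi_analytic : analytic_on_itv mu L psi)
    (hpsi_laurent : forall z, mu <= z <= L -> laurent_sum c z (psi z))
    (hpsi_pos : forall z, mu <= z <= L -> 0 < psi z)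
    (hgamma : 0 < gamma <= 1) :
  let g := fun k => grad (quad A b) (x k) in
  let psiA := funmx lam xi psi in
  let psiAmhalf := funmx lam xi (fun z => psi z `^ (- 2^-1)) in
  let alpha := fun k => stepsize gamma psiA A (g k) in
  let xstar := invmx A *m b in
  let lhs := fun k => normmx (psiA *m A) (x k.+1 - xstar) ^+ 2 in
  let rhs := fun k =>
    (1 - 4 * gamma * (2 - gamma) * mu * L / (L + mu) ^+ 2)
      * normmx (psiA *m A) (x k - xstar) ^+ 2 in
  (forall k, g k != 0 -> x k.+1 = x k - alpha k *: g k) ->
  forall k,
    (g k != 0 -> lhs k <= rhs k) /\
    (x k = invmx A *m
             ((Num.sqrt 2)^-1 *: (psiAmhalf *m (xi ord0 + xi ord_max)) + b) \/
     x k = invmx A *m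
             ((Num.sqrt 2)^-1 *: (psiAmhalf *m (xi ord0 - xi ord_max)) + b) ->
     lhs k = rhs k).
Proof.
move=> g psiA psiAmhalf alpha xstar lhs rhs step k.
have At := hA.1.
have lamP i : mu <= lam i <= L.
  rewrite -hmu -hL; apply/andP; split.
    case: (eqVneq i ord0) => [->//|i0].
    by apply/ltW/hlam; rewrite lt0n.
  case: (eqVneq i ord_max) => [->//|im].
  apply/ltW/hlam; rewrite ltn_neqAle -ltnS ltn_ord andbT.
  by apply: contra im => /eqP im; apply/eqP/val_inj.
have lam0 i : 0 < lam i by have /andP[/(lt_le_trans hmu0)] := lamP i.
have psi0 i : 0 < psi (lam i) by exact/hpsi_pos/lamP.
have L0 : 0 < L by rewrite -hL.
have Au : A \in unitmx.
  by apply: (unitmx_eigen At hxi) => i; rewrite gt_eqF.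
set e := x k - xstar.
have gE : g k = A *m e.
  by rewrite /g grad_quad // /e mulmxBr mulKVmx.
have PAE := funmx_mulA psi At hxi.
have sqnormE v : normmx (psiA *m A) v ^+ 2 = dotcv v (psiA *m A *m v).
  rewrite /normmx sqr_sqrtr // /psiA PAE dotcv_funmx; apply: sumr_ge0 => i _.
  by rewrite -expr2 mulr_ge0 ?sqr_ge0 // mulr_ge0 // ltW.
pose w i := psi (lam i) * dotcv (xi i) (g k) ^+ 2.
have w0 i : 0 <= w i by rewrite mulr_ge0 ?sqr_ge0 ?ltW.
pose H := \sum_i w i / lam i; pose S := \sum_i w i.
pose T := \sum_i w i * lam i.
have HE : dotcv e (psiA *m A *m e) = H.
  rewrite /psiA PAE dotcv_funmx; apply: eq_bigr => i _.
  by rewrite /w gE (dotcv_eigen_mul _ _ At hxi); field; rewrite gt_eqF.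
have SE : dotcv (g k) (psiA *m g k) = S.
  by rewrite dotcv_funmx; apply: eq_bigr.
have TE : dotcv (g k) (psiA *m A *m g k) = T.
  by rewrite /psiA PAE dotcv_funmx; apply: eq_bigr => i _; rewrite /w; ring.
have lhsE : g k != 0 -> T != 0 -> lhs k = H - gamma * (2 - gamma) * (S ^+ 2 / T).
  move=> gk0 T0; rewrite /lhs sqnormE step // addrAC -/e /alpha.
  rewrite gE in SE TE *.
  rewrite (sqnorm_stepsize _ At hxi) -/psiA ?TE //.
  by rewrite HE SE.
have rhsE : rhs k = (1 - 4 * gamma * (2 - gamma) * mu * L / (L + mu) ^+ 2) * H.
  by rewrite /rhs sqnormE HE.
have Lmu0 : 0 < L + mu by exact: addr_gt0.
split=> [gk0 | xk].
  have T0 : 0 < T.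
    rewrite -TE /psiA PAE; apply: (funmx_form_gt0 hxi) => // i.
    exact: mulr_gt0.
  rewrite lhsE ?gt_eqF // rhsE mulrBl mul1r lerB //.
  have -> : 4 * gamma * (2 - gamma) * mu * L / (L + mu) ^+ 2 * H
      = gamma * (2 - gamma) * (4 * mu * L * H / (L + mu) ^+ 2).
    by field; rewrite gt_eqF.
  have /andP[gamma0 gamma1] := hgamma.
  apply: ler_wpM2l; first by rewrite mulr_ge0 ?ltW //; lra.
  rewrite ler_pdivlMr // mulrAC ler_pdivrMr ?exprn_gt0 //.
  have := kantorovich hmu0 lamP w0.
  by rewrite -/H -/S -/T; lra.
have [eps eps1 gkE] : exists2 eps : R, eps ^+ 2 = 1 & g k =
    (Num.sqrt 2)^-1 *: (psiAmhalf *m (xi ord0 + eps *: xi ord_max)).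
  case: xk => xk; [exists 1 | exists (-1)]; rewrite ?expr1n ?sqrrN ?expr1n //;
    by rewrite /g grad_quad // xk mulKVmx // addrK ?scale1r ?scaleN1r.
have moment f : \sum_i w i * f (lam i) = (f mu + f L) / 2.
  by rewrite /w gkE (moment_extremal_gradient f hxi psi0 eps1) hmu hL.
have TV : T = (mu + L) / 2 := moment id.
have HV : H = (mu^-1 + L^-1) / 2 := moment GRing.inv.
have SV : S = 1.
  have <- : (1 + 1) / 2 = 1 :> R by field.
  by rewrite -(moment (fun=> 1)); apply: eq_bigr => i _; rewrite mulr1.
have gk0 : g k != 0.
  apply/eqP => g0; have := SE; rewrite g0 SV mulmx0 /dotcv mulmx0 mxE.
  by move/eqP; rewrite eq_sym oner_eq0.
rewrite lhsE // ?TV ?gt_eqF ?divr_gt0 // ?rhsE ?HV ?SV; last by rewrite addr_gt0.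
by field; rewrite !gt_eqF // addrC.
Qed.
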